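(* Let $r,s,n$ be positive integers with $s\leq r$. Consider a coloring of the edges of the complete graph $K_n$ with colors from $[r]=\{1,\dots,r\}$ such that no triangle has its three edges colored with three distinct colors. For $S\subseteq[r]$, let $G_S$ denote the graph on the vertex set of $K_n$ whose edges are exactly the edges of $K_n$ with color in $S$. Then $$n^{\binom{r-1}{s-1}}\leq \prod_{S\subseteq[r],\,|S|=s} \chi(G_S),$$ where $\chi$ denotes chromatic number.
   Context: A triangle whose three edges have three distinct colors is called a rainbow triangle; such colorings without rainbow triangles are called Gallai colorings. Each $G_S$ is a spanning subgraph, so it has all $n$ vertices (and $\chi(G_S)\ge 1$). *)

(* Defs.v *)
From mathcomp Require Import all_boot.

Set Implicit Arguments.
Unset Strict Implicit.
Unset Printing Implicit Defensive.

Record sgraph (T : finType) := SGraph {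
  adj :> rel T;
  adj_sym : symmetric adj;
  adj_irr : irreflexive adj }.

Definition proper_coloring (T : finType) (k : nat) (G : sgraph T)
    (f : {ffun T -> 'I_k}) : bool :=
  [forall x, forall y, G x y ==> (f x != f y)].

Definition colorable (T : finType) (G : sgraph T) (k : nat) : bool :=
  [exists f : {ffun T -> 'I_k}, proper_coloring G f].

Lemma ex_colorable (T : finType) (G : sgraph T) : exists k, colorable G k.
Proof.
exists #|T|; apply/existsP; exists [ffun x => enum_rank x].
apply/forallP => x; apply/forallP => y; apply/implyP => Gxy.
rewrite !ffunE; apply/eqP => /enum_rank_inj exy.
by move: Gxy; rewrite exy adj_irr.
Qed.

Definition chromatic_number (T : finType) (G : sgraph T) : nat :=
  ex_minn (ex_colorable G).

(* The edge xy has color [c x y = c y x]; the diagonal values [c x x] are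
   meaningless and are never used. *)
Record edge_coloring (T C : finType) := EdgeColoring {
  edge_color :> T -> T -> C;
  edge_colorC : forall x y, edge_color x y = edge_color y x }.

Definition rainbow_triangle (T C : finType) (c : edge_coloring T C)
    (x y z : T) : Prop :=
  [/\ x != y, y != z & x != z] /\
  [/\ c x y != c y z, c y z != c x z & c x y != c x z].

Definition gallai_coloring (T C : finType) (c : edge_coloring T C) : Prop :=
  forall x y z : T, ~ rainbow_triangle c x y z.

Section ColorGraph.
Variables (T C : finType) (c : edge_coloring T C) (S : {set C}).

Definition color_adj : rel T := fun x y => (x != y) && (c x y \in S).

Lemma color_adj_sym : symmetric color_adj.
Proof. by move=> x y; rewrite /color_adj eq_sym edge_colorC. Qed.

Lemma color_adj_irr : irreflexive color_adj.
Proof. by move=> x; rewrite /color_adj eqxx. Qed.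

Definition color_graph : sgraph T := SGraph color_adj_sym color_adj_irr.

End ColorGraph.

(* Main.v *)
Require Import Defs.
From mathcomp Require Import all_boot all_order all_algebra all_fingroup.

(* Some two colours [i], [j] disconnect the graph of all remaining colours
   (Gallai); the components of that graph are modules, so the edges between two
   of them share one colour, [i] or [j]. Given proper colourings [f_S] of all
   the [G_S], we induct on vertex sets. For [S] containing both [i] and [j], the
   images of distinct components under [f_S] are disjoint. For [S] containing
   [i] but not [j], let [S'] be [S] with [i] and [j] exchanged: the rectangles
   [f_S(B) x f_S'(B)] of distinct components [B] are disjoint. This yields one
   superadditive quantity for each of the ['C(r-1, s-1)] sets [S] containing
   [i]; Hoelder's inequality combines them, while the sets avoiding [i] and [j]
   only contribute a common factor. *)

Set Implicit Arguments.
Unset Strict Implicit.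
Unset Printing Implicit Defensive.

(** * Gallai's decomposition of a colouring without rainbow triangles *)

Section Decomposition.
Variables (T C : finType) (c : edge_coloring T C).
Hypothesis c_gallai : gallai_coloring c.

Lemma gallai_two_eq (x y z : T) : x != y -> y != z -> x != z ->
  [|| c x y == c y z, c y z == c x z | c x y == c x z].
Proof.
move=> xy yz xz; apply/negPn/negP; rewrite !negb_or => /and3P[h1 h2 h3].
exact: (c_gallai (conj (And3 xy yz xz) (And3 h1 h2 h3))).
Qed.

(** Loops may occur; they do not affect connectivity. *)
Definition other_color_rel (D : {set T}) (i j : C) : rel T :=
  [rel x y | [&& x \in D, y \in D & c x y \notin [:: i; j]]].

Lemma other_color_connect_sym D i j : connect_sym (other_color_rel D i j).
Proof.
apply: sym_connect_sym => x y.
by rewrite /other_color_rel /= andbCA edge_colorC.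
Qed.

Lemma other_color_connect_in D i j x y :
  connect (other_color_rel D i j) x y -> x \in D -> y \in D.
Proof.
move=> xy; rewrite (closed_connect (a := mem D) _ xy) // => u v.
by case/and3P=> -> ->.
Qed.

Lemma disconnected_color (D : {set T}) i j x y : x \in D -> y \in D ->
  ~~ connect (other_color_rel D i j) x y -> c x y \in [:: i; j].
Proof.
move=> xD yD; apply: contraR => cxy; apply: connect1.
by rewrite /other_color_rel /= xD yD cxy.
Qed.

(** An edge [x u] of the path has neither colour [i] nor [j], while the edges from [x] and [u] to
    [y] have one of these; as the triangle is not rainbow, the latter two agree. *)
Lemma connect_eq_color (D : {set T}) i j x x' y : x \in D -> y \in D ->
    connect (other_color_rel D i j) x x' ->
    ~~ connect (other_color_rel D i j) x y ->
  c x y = c x' y.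
Proof.
set e := other_color_rel D i j => xD yD /connectP[p pxp ->{x'}].
elim: p x xD pxp => //= u p IHp x xD /andP[xu pu] nxy.
have /and3P[_ uD cxu] := xu.
have nuy : ~~ connect e u y.
  by apply: contra nxy; apply: connect_trans; apply: connect1.
rewrite -(IHp u uD pu) //.
have [-> // | x_u] := eqVneq x u.
have uy : u != y by apply: contraNneq nuy => ->.
have x_y : x != y by apply: contraNneq nxy => ->.
have cxy := disconnected_color xD yD nxy.
have cuy := disconnected_color uD yD nuy.
case/or3P: (gallai_two_eq x_u uy x_y) => /eqP E //.
  by rewrite E cuy in cxu.
by rewrite E cxy in cxu.
Qed.

Lemma isolated_disconnected (D : {set T}) i j v w : w != v ->
    {in D, forall u, u != v -> c v u \in [:: i; j]} ->
  ~~ connect (other_color_rel D i j) v w.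
Proof.
move=> wv cv; apply/negP => /(closed_connect (a := pred1 v)) h.
suff /h : closed (other_color_rel D i j) (pred1 v).
  by rewrite !inE eqxx (negPf wv).
apply: (intro_closed (@other_color_connect_sym _ _ _)) => x y /and3P[_ yD cxy].
rewrite !inE => /eqP xv; rewrite xv in cxy; apply: contraR cxy.
exact: cv.
Qed.

(** Induction on [#|D|], removing a vertex [v]: the pair [i], [j] that disconnects the rest either
    still works or is replaced by a pair that isolates [v]. *)
Lemma gallai_disconnected (D : {set T}) : 1 < #|D| ->
  exists i j x y,
    [/\ x \in D, y \in D & ~~ connect (other_color_rel D i j) x y].
Proof.
elim: {D}_.+1 {-2}D (ltnSn #|D|) => // m IHm D ltDm D2.
have /card_gt0P[v vD] : 0 < #|D| by apply: ltn_trans D2.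
pose D' := D :\ v.
have cardD : #|D| = #|D'|.+1 by rewrite (cardsD1 v D) vD.
have isolate i j : {in D', forall u, c v u \in [:: i; j]} ->
    exists i j x y,
      [/\ x \in D, y \in D & ~~ connect (other_color_rel D i j) x y].
  move=> cv; have /card_gt0P[w] : 0 < #|D'| by rewrite cardD in D2.
  rewrite in_setD1 => /andP[wv wD]; exists i, j, v, w; split=> //.
  apply: isolated_disconnected => // u uD uv.
  by apply: cv; rewrite in_setD1 uv.
have [D'1|D'2] := leqP #|D'| 1.
  have /cards1P[w D'w] : #|D'| == 1 by rewrite eqn_leq D'1; rewrite cardD in D2.
  apply: (isolate (c v w) (c v w)) => u.
  by rewrite D'w inE => /eqP->; rewrite inE eqxx.
have [|i [j [x [y [xD yD nxy]]]]] := IHm D' _ D'2; first by rewrite -cardD.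
set e := other_color_rel D' i j in nxy.
have esym : connect_sym e := @other_color_connect_sym _ _ _.
have inD' u : u \in D' -> (u \in D) && (u != v) by rewrite in_setD1 andbC.
(* A component joined to [v] only by [i] and [j] stays a component when [v] is added back. *)
have [/existsP[z /andP[zD /forallP hz]] | noz] :=
    boolP [exists z in D', [forall w, connect e z w ==> (c v w \in [:: i; j])]].
  have /andP[zD0 zv] := inD' z zD.
  exists i, j, z, v; split=> //; apply/negP.
  move=> /(closed_connect (a := [pred w | connect e z w])) h.
  have nzv : connect e z v = false.
    by apply/negP => /other_color_connect_in /(_ zD) /inD'; rewrite eqxx andbF.
  suff /h : closed (other_color_rel D i j) [pred w | connect e z w].
    by rewrite !inE connect0 nzv.
  apply: (intro_closed (@other_color_connect_sym _ _ _)) => u u'.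
  case/and3P=> _ u'D cuu'; rewrite !inE => zu.
  have uD' := other_color_connect_in zu zD.
  have [u'v | u'v] := eqVneq u' v.
    by have := implyP (hz u) zu; rewrite edge_colorC -u'v (negPf cuu').
  apply: connect_trans zu (connect1 _).
  by rewrite /e /other_color_rel /= uD' cuu' in_setD1 u'v u'D.
have third z : z \in D' ->
    exists2 w, (w \in D') && connect e z w & c v w \notin [:: i; j].
  move=> zD; move/existsPn/(_ z): noz; rewrite zD /= => /forallPn[w].
  rewrite negb_imply => /andP[zw cvw]; exists w => //.
  by rewrite zw (other_color_connect_in zw).
have sep u : exists2 u', u' \in [:: x; y] & ~~ connect e u u'.
  have [ux|nux] := boolP (connect e u x); last by exists x; rewrite ?mem_head.
  by exists y; rewrite ?inE ?eqxx ?orbT // (same_connect esym ux).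
have sameD u : u \in [:: x; y] -> u \in D'.
  by rewrite in_cons mem_seq1 => /orP[] /eqP->.
have cross u w : u \in D' -> w \in D' -> ~~ connect e u w ->
    c u w \in [:: i; j] /\ [|| c v u == c u w, c u w == c v w | c v u == c v w].
  move=> uD wD nuw; split; first exact: disconnected_color nuw.
  have [/andP[_ uv] /andP[_ wv]] := (inD' u uD, inD' w wD).
  by apply: gallai_two_eq; rewrite 1?eq_sym //; apply: contraNneq nuw => ->.
(* The edge [u w] has colour [i] or [j], so the two equal colours in the triangle [v u w] must be
   those at [v]. *)
have third_eq u w : u \in D' -> w \in D' -> ~~ connect e u w ->
    c v u \notin [:: i; j] -> c v w \notin [:: i; j] -> c v u = c v w.
  move=> uD wD nuw cu cw; have [cuw] := cross u w uD wD nuw.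
  by case/or3P=> /eqP E //; [rewrite E cuw in cu | rewrite -E cuw in cw].
have [wx /andP[wxD xwx] cwx] := third x xD.
have [wy /andP[wyD ywy] cwy] := third y yD.
have nwxy : ~~ connect e wx wy.
  by rewrite -(same_connect esym xwx) esym -(same_connect esym ywy) esym.
have cwxy := third_eq wx wy wxD wyD nwxy cwx cwy.
(* Since [wx] and [wy] lie in different components, [u] is separated from one of them: only one
   third colour occurs at [v]. *)
have third_k u : u \in D' -> c v u \notin [:: i; j] -> c v u = c v wx.
  move=> uD cu.
  have [uwx|nuwx] := boolP (connect e u wx); last exact: third_eq.
  by rewrite cwxy; apply: third_eq => //; rewrite (same_connect esym uwx).
(* Some [w] in the component of [u] has a third colour to [v]; the triangle [v z w] forces
   [c z w = a], and [c z u = c z w]. *)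
have spread z u a : z \in D' -> u \in D' -> ~~ connect e z u ->
    a \in [:: i; j] -> c v z = a -> c z u = a.
  move=> zD uD nzu aij cvz.
  have [w /andP[wD uw] cw] := third u uD.
  have nzw : ~~ connect e z w.
    by rewrite esym -(same_connect esym uw) esym.
  have nuz : ~~ connect e u z by rewrite esym.
  rewrite edge_colorC (connect_eq_color uD zD uw nuz) edge_colorC.
  have [czw] := cross z w zD wD nzw; rewrite cvz => /or3P[] /eqP E //.
    by rewrite -E czw in cw.
  by rewrite -E aij in cw.
(* If at most one colour [a] among [i], [j] occurs at [v], then [a] and the third colour isolate
   [v]. *)
have all_k a : {in D', forall u, c v u \in [:: i; j] -> c v u = a} ->
    exists i j x y,
      [/\ x \in D, y \in D & ~~ connect (other_color_rel D i j) x y].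
  move=> ha; apply: (isolate a (c v wx)) => u uD.
  have [cu|/(third_k u uD) ->] := boolP (c v u \in [:: i; j]).
    by rewrite (ha u uD cu) mem_head.
  by rewrite !inE eqxx orbT.
have [/existsP[z1 /andP[z1D /eqP cz1]] | ni] :=
    boolP [exists z in D', c v z == i]; last first.
  apply: (all_k j) => u uD; rewrite !inE => /orP[/eqP cu|/eqP //].
  by case/existsP: ni; exists u; rewrite uD cu /=.
have [/existsP[z2 /andP[z2D /eqP cz2]] | nj] :=
    boolP [exists z in D', c v z == j]; last first.
  apply: (all_k i) => u uD; rewrite !inE => /orP[/eqP //|/eqP cu].
  by case/existsP: nj; exists u; rewrite uD cu /=.
suff ij : i = j by apply: (all_k i) => u uD; rewrite -ij !inE orbb => /eqP.
have [iI jI] : i \in [:: i; j] /\ j \in [:: i; j] by rewrite !inE !eqxx orbT.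
(* In one component, [z1] and [z2] send the same colour to [u], so it is both [i] and [j]; otherwise
   this holds for the edge [z1 z2]. *)
have [z12|nz12] := boolP (connect e z1 z2).
  have [u /sameD uD nz1u] := sep z1.
  rewrite -(spread z1 u i) // (connect_eq_color z1D uD z12 nz1u).
  by apply: spread; rewrite // -(same_connect esym z12).
rewrite -(spread z1 z2 i) // edge_colorC; apply: spread => //.
by rewrite esym.
Qed.

(* Gallai's theorem, with the parts encoded as the fibres of [p] in [D]. *)
Lemma gallai_partition (D : {set T}) : 1 < #|D| ->
  exists i j (p : T -> T),
    [/\ {in D &, forall x y, p x != p y -> c x y \in [:: i; j]},
        {in D & &, forall x x' y, p x = p x' -> p x != p y -> c x y = c x' y}
      & exists x y, [/\ x \in D, y \in D & p x != p y]].
Proof.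
move=> D2; have [i [j [x [y [xD yD nxy]]]]] := gallai_disconnected D2.
have esym : connect_sym (other_color_rel D i j) := @other_color_connect_sym _ _ _.
exists i, j, (fingraph.root (other_color_rel D i j)); split=> //.
- move=> u w uD wD; rewrite (root_connect esym); exact: disconnected_color.
- move=> u u' w uD u'D wD /eqP; rewrite !(root_connect esym).
  exact: connect_eq_color.
- by exists x, y; rewrite (root_connect esym).
Qed.

End Decomposition.

(** * Hoelder's inequality for natural numbers *)

Section Hoelder.
Import GRing.Theory Num.Theory Order.TTheory.

(** Hoelder with [#|A|] equal exponents, raised to the power [#|A|]; [M] carries the factor common
    to all terms. *)
Lemma expn_sum_leq_prod_sum (I J : finType) (A : {set J}) (a : J -> I -> nat)
    (n : I -> nat) (M : nat) :
    0 < #|A| -> (forall i, n i ^ #|A| <= M * \prod_(j in A) a j i) ->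
  (\sum_i n i) ^ #|A| <= M * \prod_(j in A) \sum_i a j i.
Proof.
set k := #|A| => k0 hn; set N := \sum_i n i.
rewrite leqNgt; apply/negP => lt_prod.
(* Assuming the inequality fails lets AM-GM be applied to the [k]-th powers, so
   that no [k]-th roots are needed. *)
have N0 : 0 < N by case: (posnP N) lt_prod => // ->; rewrite exp0n.
have [i0 ni0] : exists i, 0 < n i.
  by apply/existsP; apply: contraLR N0 => /existsPn h; rewrite -leqNgt leqn0;
    rewrite /N sum_nat_eq0; apply/forallP=> i; rewrite -leqn0 leqNgt h.
(* For [j] in [A], dividing by the sum turns [a j] into a probability distribution [p j] on [I]. *)
pose sg j : rat := (\sum_i a j i)%:R%R.
pose p j i : rat := ((a j i)%:R / sg j)%R.
have sg_ge0 j : (0 <= sg j)%R by apply: ler0n.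
have p_ge0 j i : (0 <= p j i)%R by apply: divr_ge0.
have sg_gt0 j : j \in A -> (0 < sg j)%R.
  move=> jA; rewrite ltr0n lt0n; apply: contraL ni0 => /eqP s0.
  have := hn i0; rewrite (bigD1 j) //=.
  move/eqP: s0; rewrite sum_nat_eq0 => /forallP/(_ i0)/eqP->.
  by rewrite mul0n muln0 leqn0 expn_eq0 k0 andbT -leqNgt => /eqP->.
have scaled i : ((n i)%:R ^+ k <= (M * \prod_(j in A) \sum_i a j i)%:R *
    \prod_(j in A) p j i :> rat)%R.
  have -> : ((M * \prod_(j in A) \sum_i a j i)%:R * \prod_(j in A) p j i
      = (M * \prod_(j in A) a j i)%:R :> rat)%R.
    rewrite !natrM -mulrA !natr_prod -big_split /=; congr (_ * _)%R.
    apply: eq_bigr => j jA; rewrite mulrC divfK //.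
    by apply: lt0r_neq0; apply: sg_gt0.
  by rewrite -natrX ler_nat.
have agm i : (\prod_(j in A) p j i <= ((\sum_(j in A) p j i) / k%:R) ^+ k)%R.
  exact: (leif_AGM (fun j _ => p_ge0 j i)).
have mu_ge0 i : (0 <= (\sum_(j in A) p j i) / k%:R)%R.
  by rewrite divr_ge0 ?ler0n // sumr_ge0.
(* By [lt_prod] and AM-GM, a positive [n i] is less than [N] times the mean of the [p j i]; these
   means sum to 1, so adding over [i] gives [N < N]. *)
have bound i : 0 < n i ->
    ((n i)%:R < N%:R * ((\sum_(j in A) p j i) / k%:R) :> rat)%R.
  move=> ni; rewrite -(@ltr_pXn2r _ k) ?nnegrE
     ?ler0n ?(mulr_ge0 (ler0n _ _) (mu_ge0 i)) //.
  apply: le_lt_trans (scaled i) _.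
  have p_gt0 : (0 < \prod_(j in A) p j i)%R.
    rewrite lt0r prodr_ge0 // andbT; apply: contraTneq (scaled i) => ->.
    by rewrite mulr0 -ltNge exprn_gt0 // ltr0n.
  rewrite exprMn; apply: lt_le_trans (ler_wpM2l _ (agm i)); last first.
    by rewrite exprn_ge0 // ler0n.
  by rewrite ltr_pM2r // -natrX ltr_nat.
have sum_mu : (\sum_i (\sum_(j in A) p j i) / k%:R = 1 :> rat)%R.
  rewrite -mulr_suml exchange_big /= (eq_bigr (fun _ => 1%R)).
    by rewrite sumr_const divff // pnatr_eq0 -lt0n.
  move=> j jA; rewrite -mulr_suml -natr_sum divff //.
  by apply: lt0r_neq0; apply: sg_gt0.
suff : (N%:R < N%:R * (\sum_i (\sum_(j in A) p j i) / k%:R) :> rat)%R.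
  by rewrite sum_mu mulr1 ltxx.
have N_sum : (N%:R = \sum_i (n i)%:R :> rat)%R by rewrite natr_sum.
rewrite {1}N_sum mulr_sumr (bigD1 i0) //= [ltRHS](bigD1 i0) //=.
apply: ltr_leD; first exact: bound.
apply: ler_sum => i _; have [->|/bound/ltW //] := posnP (n i).
exact: mulr_ge0 (ler0n _ _) (mu_ge0 i).
Qed.

End Hoelder.

(** * Counting lemmas *)

Lemma sum_card_disjoint_leq (I U : finType) (F : I -> {set U}) (E : {set U}) :
    (forall i, F i \subset E) ->
    (forall i j, i != j -> [disjoint F i & F j]) ->
  \sum_i #|F i| <= #|E|.
Proof.
move=> FE dF.
have -> : \sum_i #|F i| = \sum_(u in E) \sum_i (u \in F i).
  rewrite exchange_big; apply: eq_bigr => i _.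
  rewrite -sum1_card big_mkcond [RHS]big_mkcond /=; apply: eq_bigr => u _.
  by have := subsetP (FE i) u; case: (u \in F i) => [->|_] //; case: ifP.
rewrite -sum1_card; apply: leq_sum => u _.
have [/existsP[i ui]|nu] := boolP [exists i, u \in F i].
  rewrite (bigD1 i) //= ui big1 // => j ji.
  by rewrite (disjointFl (dF j i ji) ui).
by rewrite big1 // => i _; have /existsPn/(_ i)/negPf-> := nu.
Qed.

(** Pascal's rule: the sets of size [s] avoiding [i] are the [s]-subsets of the complement of
    [i]. *)
Lemma card_draws_mem (C : finType) (i : C) (s : nat) : 0 < s ->
  #|[set S : {set C} | (#|S| == s) && (i \in S)]| = 'C(#|C|.-1, s.-1).
Proof.
case: s => // s _; apply/eqP.
have C0 : 0 < #|C| by apply/card_gt0P; exists i.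
pose B := [set S : {set C} | #|S| == s.+1].
rewrite -(eqn_add2r #|B :\: [set S : {set C} | i \in S]|).
have -> : [set S : {set C} | (#|S| == s.+1) && (i \in S)]
    = B :&: [set S : {set C} | i \in S].
  by apply/setP=> S; rewrite !inE.
rewrite cardsID card_draws -{1}(prednK C0) binS addnC eqn_add2l /=.
rewrite -[in 'C(_, _)](cardsC1 i) -cards_draws; apply/eqP/eq_card => S.
by rewrite !inE subsetC sub1set inE andbC.
Qed.

(** * Pairing colour sets by exchanging two colours *)

Section SwapColors.
Variables (C : finType) (i j : C) (s : nat).

Definition swap_set (S : {set C}) : {set C} := [set tperm i j x | x in S].

(** Meant for [S] containing [i]. If [j] is in [S], the exchange fixes [S], which must count once;
    otherwise the image contains [j] but not [i], and its factor is absorbed here. *)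
Definition swap_pair (F : {set C} -> nat) (S : {set C}) : nat :=
  F S * (if j \in S then 1 else F (swap_set S)).

Lemma prod_swap_pair (F : {set C} -> nat) :
  \prod_(S : {set C} | #|S| == s) F S =
  (\prod_(S : {set C} | (#|S| == s) && (i \notin S) && (j \notin S)) F S) *
  \prod_(S : {set C} | (#|S| == s) && (i \in S)) swap_pair F S.
Proof.
rewrite (bigID (fun S : {set C} => i \in S)) /= mulnC.
rewrite (bigID (fun S : {set C} => j \in S) (fun S => _ && (i \notin S))) /=.
rewrite [X in X * _]mulnC -mulnA; congr (_ * _).
rewrite mulnC big_split /=; congr (_ * _).
rewrite (reindex_inj (imset_inj (@perm_inj _ (tperm i j)))) /=.
rewrite [RHS](bigID (fun S : {set C} => j \in S)) /=.
rewrite [X in _ = X * _]big1; last first.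
  by move=> S /andP[_ ->].
have swap_i S : (i \in swap_set S) = (j \in S).
  by rewrite -{1}(tpermR i j) mem_imset //; apply: perm_inj.
have swap_j S : (j \in swap_set S) = (i \in S).
  by rewrite -{1}(tpermL i j) mem_imset //; apply: perm_inj.
rewrite mul1n; apply: eq_big => [S | S].
  rewrite -/(swap_set S) swap_i swap_j card_imset; last exact: perm_inj.
  by rewrite andbAC.
by rewrite -/(swap_set S) swap_i => /andP[/andP[_ /negPf->]].
Qed.

End SwapColors.

(** * Induction on vertex sets, and the theorem *)

(** The maps [f S] stay fixed and only their images on [D] are counted: properness passes to
    subsets, and the colours used on different parts can be compared. *)
Lemma gallai_card_images (T C : finType) (c : edge_coloring T C) (s : nat)
    (K : {set C} -> finType) (f : forall S, T -> K S) (D : {set T}) :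
    gallai_coloring c -> 0 < s <= #|C| ->
    (forall S : {set C}, {in D &, forall x y,
      x != y -> c x y \in S -> f S x != f S y}) ->
  #|D| ^ 'C(#|C|.-1, s.-1) <= \prod_(S : {set C} | #|S| == s) #|f S @: D|.
Proof.
move=> c_gallai /andP[s0 sC].
have C0 : 0 < #|C| by apply: leq_trans sC.
have bin0 : 0 < 'C(#|C|.-1, s.-1) by rewrite bin_gt0 -ltnS !prednK.
elim: {D}_.+1 {-2}D (ltnSn #|D|) => // m IHm D ltDm f_proper.
have [D1|D2] := leqP #|D| 1.
  (* The exponent is positive, so the empty set gives 0; for one vertex all images are nonempty. *)
  have [-> | /set0Pn[x xD]] := eqVneq D set0; first by rewrite cards0 exp0n.
  apply: (@leq_trans 1); first by rewrite -(exp1n 'C(#|C|.-1, s.-1)) leq_exp2r.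
  by apply: prodn_gt0 => S; apply/card_gt0P; exists (f S x); apply: imset_f.
have [i [j [p [c_ij c_module [x0 [y0 [x0D y0D xy0]]]]]]] :=
  gallai_partition c_gallai D2.
(* Blocks are indexed by all of [T]; empty ones contribute 0 to the sums. *)
pose B z := [set x in D | p x == z].
have BD z : B z \subset D by apply/subsetP => x; rewrite inE => /andP[].
have cardD : #|D| = \sum_z #|B z|.
  rewrite -sum1_card (partition_big p xpredT) //=; apply: eq_bigr => z _.
  by rewrite -sum1_card; apply: eq_bigl => x; rewrite inE.
have cardB z : #|B z| < m.
  rewrite -ltnS; apply: leq_trans ltDm; apply: proper_card.
  rewrite properE BD; apply/subsetPn.
  have [pz|pz] := eqVneq (p x0) z.
    by exists y0; rewrite // inE y0D -pz eq_sym.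
  by exists x0; rewrite // inE x0D.
pose A := [set S : {set C} | (#|S| == s) && (i \in S)].
have cardA : #|A| = 'C(#|C|.-1, s.-1) by apply: card_draws_mem.
pose F (E : {set T}) S := #|f S @: E|.
pose M := \prod_(S : {set C} | (#|S| == s) && (i \notin S) && (j \notin S))
  F D S.
have F_sub z S : F (B z) S <= F D S by apply/subset_leq_card/imsetS.
have prodA E : \prod_(S : {set C} | (#|S| == s) && (i \in S))
      swap_pair i j (F E) S
    = \prod_(S in A) swap_pair i j (F E) S.
  by apply: eq_bigl => S; rewrite inE.
(* The factors of sets avoiding [i] and [j] are enlarged from [B z] to [D], which makes [M]
   independent of [z]. *)
have block z : #|B z| ^ #|A| <= M * \prod_(S in A) swap_pair i j (F (B z)) S.
  rewrite cardA; apply: leq_trans (IHm (B z) (cardB z) _) _.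
    move=> S x y /(subsetP (BD z)) xD /(subsetP (BD z)); exact: f_proper.
  rewrite (prod_swap_pair i j) prodA leq_mul2r; apply/orP; right.
  by rewrite /M; apply: leq_prod => S _; apply: F_sub.
have same (S : {set C}) x y : x \in D -> y \in D ->
    p x != p y -> f S x = f S y -> c x y \notin S.
  move=> xD yD pxy /eqP; apply: contraL; apply: f_proper => //.
  by apply: contraNneq pxy => ->.
have merge (S : {set C}) : S \in A ->
    \sum_z swap_pair i j (F (B z)) S <= swap_pair i j (F D) S.
  rewrite inE /swap_pair => /andP[_ iS].
  have [jS|jS] := boolP (j \in S).
    rewrite muln1 (eq_bigr (fun z => #|f S @: B z|)); last first.
      by move=> z _; rewrite muln1.
    apply: sum_card_disjoint_leq => [z|z z' zz']; first exact: imsetS.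
    rewrite -setI_eq0; apply/eqP/setP => u; rewrite !inE; apply/negP.
    case/andP=> /imsetP[x]; rewrite inE => /andP[xD /eqP xz] ->.
    case/imsetP=> y; rewrite inE => /andP[yD /eqP yz] fxy.
    have pxy : p x != p y by rewrite xz yz.
    have /negP[] := same S x y xD yD pxy fxy.
    by have := c_ij x y xD yD pxy; rewrite !inE => /orP[] /eqP->.
  set S' := swap_set i j S.
  have jS' : j \in S' by apply/imsetP; exists i; rewrite ?tpermL.
  have -> : F D S * F D S' = #|setX (f S @: D) (f S' @: D)| by rewrite cardsX.
  rewrite (eq_bigr (fun z => #|setX (f S @: B z) (f S' @: B z)|)); last first.
    by move=> z _; rewrite cardsX.
  apply: sum_card_disjoint_leq => [z|z z' zz'].
    by apply: setXS; apply: imsetS.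
  rewrite -setI_eq0; apply/eqP/setP => -[u v]; rewrite !inE /=; apply/negP.
  case/andP=> /andP[/imsetP[x]]; rewrite inE => /andP[xD /eqP xz] -> {u}.
  case/imsetP=> x'; rewrite inE => /andP[x'D /eqP xz'] -> {v}.
  case/andP=> /imsetP[y]; rewrite inE => /andP[yD /eqP yz] fxy.
  case/imsetP=> y'; rewrite inE => /andP[y'D /eqP yz'] fxy'.
  have pxy : p x != p y by rewrite xz yz.
  have pxy' : p x' != p y' by rewrite xz' yz'.
  have cxy := same S x y xD yD pxy fxy.
  have cxy' := same S' x' y' x'D y'D pxy' fxy'.
  (* Both edges join the same two parts; one endpoint is changed at a time. The common colour is [i]
     or [j], but [i] lies in [S] and [j] in [S']. *)
  have E : c x y = c x' y'.
    rewrite (c_module x x' y) //; last by rewrite xz xz'.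
    rewrite edge_colorC (c_module y y' x') //; first exact: edge_colorC.
      by rewrite yz yz'.
    by rewrite yz xz' eq_sym.
  have := c_ij x y xD yD pxy; rewrite !inE => /orP[] /eqP cE.
    by rewrite cE iS in cxy.
  by rewrite -E cE jS' in cxy'.
have A0 : 0 < #|A| by rewrite cardA.
rewrite -cardA cardD (prod_swap_pair i j) prodA.
apply: leq_trans (expn_sum_leq_prod_sum A0 block) _.
by rewrite leq_mul2l leq_prod ?orbT.
Qed.

Theorem theorem3p1 (r s n : nat) (hr : 0 < r) (hs : 0 < s) (hn : 0 < n)
    (hsr : s <= r) (c : edge_coloring 'I_n 'I_r) (hc : gallai_coloring c) :
  n ^ 'C(r - 1, s - 1) <=
    \prod_(S : {set 'I_r} | #|S| == s) chromatic_number (color_graph c S).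
Proof.
have colorable_chi S :
    exists f : {ffun 'I_n -> 'I_(chromatic_number (color_graph c S))},
      proper_coloring (color_graph c S) f.
  by rewrite /chromatic_number; case: ex_minnP => k /existsP.
pose f S := xchoose (colorable_chi S).
have f_proper (S : {set _}) : {in [set: 'I_n] &, forall x y,
    x != y -> c x y \in S -> f S x != f S y}.
  move=> x y _ _ xy cxy.
  have /forallP/(_ x)/forallP/(_ y)/implyP := xchooseP (colorable_chi S).
  by apply; apply/andP.
(* With [D] the full vertex set and [f S] optimal, each image has at most [chromatic_number] many
   elements. *)
have := gallai_card_images hc _ f_proper; rewrite cardsT !card_ord !subn1.
move=> /(_ s); rewrite hs => /(_ hsr) /leq_trans; apply.
by apply: leq_prod => S _; rewrite -[leqRHS]card_ord max_card.
Qed.
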